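(* Let $G$ be a finite group. For a subgroup $H\subset G$, let $(e_{tH})_{tH\in G/H}$ be the canonical basis of the finite dimensional Riesz space $C(G/H)$, defined by $e_{tH}(sH)=\delta_{tH,sH}$ for $tH,sH\in G/H$, and let $\pi^H\colon G\to\mathrm{Aut}^+(C(G/H))$ be the canonical positive representation corresponding to the action of $G$ on $G/H$, so that $\pi^H_se_{tH}:=e_{stH}$ for $s,t\in G$. Then, whenever $H_1$ and $H_2$ are conjugate subgroups of $G$, $\pi^{H_1}$ and $\pi^{H_2}$ are order equivalent, and the map \[ [H]\mapsto[\pi^H] \] is a bijection between the conjugacy classes of subgroups of $G$ and the order equivalence classes of irreducible positive representations of $G$ in nonzero finite dimensional Archimedean Riesz spaces.
   Context: All Riesz spaces (vector lattices) are real. $\mathrm{Aut}^+(E)$ denotes the group of lattice automorphisms of a Riesz space $E$. A positive representation of $G$ in $E$ is a group homomorphism $\rho\colon G\to\mathrm{Aut}^+(E)$, $s\mapsto\rho_s$. $C(G/H)$ is the space of all real-valued functions on the finite set $G/H$ with pointwise ordering. Two positive representations $\rho$ in $E$ and $\theta$ in $F$ of $G$ are order equivalent if there is a lattice isomorphism $T\colon E\to F$ with $T\rho_s=\theta_sT$ for all $s\in G$. In a finite dimensional Archimedean Riesz space the ideals, (principal) bands and projection bands coincide, and a positive representation in such a space is called irreducible if the only invariant bands are $\{0\}$ and the whole space. $[H]$ denotes the conjugacy class of $H$ and $[\pi^H]$ the order equivalence class of $\pi^H$. *)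

(* Defs.v *)
From HB Require Import structures.
From mathcomp Require Import all_boot all_order all_algebra all_fingroup.
From mathcomp Require Import all_classical all_reals.

Set Implicit Arguments.
Unset Strict Implicit.
Unset Printing Implicit Defensive.

Import Order.TTheory GRing.Theory Num.Theory.

Local Open Scope classical_set_scope.
Local Open Scope ring_scope.

(* A Riesz space is an ordered vector space in which any two elements have a
   supremum and an infimum.  The lattice operations are declared here instead
   of inheriting from latticeType because ssrnum's realDomainType already joins
   latticeType with the additive structures. *)
HB.mixin Record POrderedLmodule_isRiesz (R : realType) E
    of Num.POrderedZmodule E & GRing.Lmodule R E := {
  riesz_meet : E -> E -> E;
  riesz_join : E -> E -> E;
  riesz_lexI : forall x y z : E,
    (z <= riesz_meet x y) = (z <= x) && (z <= y);
  riesz_leUx : forall x y z : E,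
    (riesz_join x y <= z) = (x <= z) && (y <= z);
  riesz_leD2r : forall x y z : E, x <= y -> x + z <= y + z;
  riesz_scale_ge0 : forall (a : R) (x : E), 0 <= a -> 0 <= x -> 0 <= a *: x
}.

#[short(type="rieszType")]
HB.structure Definition Riesz (R : realType) :=
  { E of Num.POrderedZmodule E & GRing.Lmodule R E
       & POrderedLmodule_isRiesz R E }.

Section RieszNotions.
Context (R : realType) (E : rieszType R).

Definition riesz_abs (x : E) : E := riesz_join x (- x).

Definition archimedean : Prop :=
  forall x y : E, 0 <= x -> (forall n : nat, x *+ n <= y) -> x = 0.

Definition finite_dimensional : Prop :=
  exists (n : nat) (b : 'I_n -> E),
    forall x : E, exists c : 'I_n -> R, x = \sum_(i < n) c i *: b i.

Definition nonzero_space : Prop := exists x : E, x <> 0.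

Definition subspace_set (B : set E) : Prop :=
  B 0 /\ forall (a : R) (x y : E), B x -> B y -> B (a *: x + y).

Definition solid (B : set E) : Prop :=
  forall x y : E, B y -> riesz_abs x <= riesz_abs y -> B x.

Definition riesz_ideal (B : set E) : Prop := subspace_set B /\ solid B.

Definition band (B : set E) : Prop :=
  riesz_ideal B /\
  forall (D : set E) (y : E), D `<=` B -> supremums D y -> B y.

End RieszNotions.

Arguments archimedean {R} E.
Arguments finite_dimensional {R} E.
Arguments nonzero_space {R} E.

Definition lattice_isomorphism (R : realType)
    (E F : rieszType R) (T : {linear E -> F}) : Prop :=
  [/\ bijective T,
      {morph T : x y / riesz_meet x y} & {morph T : x y / riesz_join x y}].

(* A positive representation of G (all of gT) together with the Riesz space on
   which it acts.  The group law of Aut^+(E) is composition, so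
   posrep_aut and posrepM say that s |-> rho_s is a group homomorphism into
   Aut^+(E); rho_1 = id follows. *)
Record posrep (R : realType) (gT : finGroupType) := PosRep {
  posrep_space : rieszType R;
  posrep_act :> gT -> {linear posrep_space -> posrep_space};
  posrep_aut : forall s : gT, lattice_isomorphism (posrep_act s);
  posrepM : forall (s t : gT) (x : posrep_space),
    posrep_act (s * t)%g x = posrep_act s (posrep_act t x)
}.

Section PositiveRepresentations.
Context (R : realType) (gT : finGroupType).
Implicit Types rho theta : posrep R gT.

Definition order_equivalent rho theta : Prop :=
  exists T : {linear posrep_space rho -> posrep_space theta},
    lattice_isomorphism T /\ forall (s : gT) x, T (rho s x) = theta s (T x).

Definition invariant rho (B : set (posrep_space rho)) : Prop :=
  forall (s : gT) x, B x -> B (rho s x).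

Definition irreducible rho : Prop :=
  forall B : set (posrep_space rho),
    band B -> invariant B -> B = [set 0] \/ B = setT.

(* Classes of representations are plain predicates: posrep R gT quantifies over
   all Riesz spaces and is too large a type for classical_sets' set. *)
Definition order_class rho : posrep R gT -> Prop := order_equivalent rho.

Definition irreducible_fd_archimedean rho : Prop :=
  [/\ nonzero_space (posrep_space rho), finite_dimensional (posrep_space rho),
      archimedean (posrep_space rho) & irreducible rho].

End PositiveRepresentations.

(* Pointwise order on {ffun T -> R^o}; the regular module R^o is used because
   {ffun T -> R^o} carries the pointwise module structure over R. *)
Section FunctionRiesz.
Context (R : realType) (T : finType).
Implicit Types f g h : {ffun T -> R^o}.

Definition ffun_le f g := [forall x, (f x : R) <= g x].
Definition ffun_lt f g := (g != f) && ffun_le f g.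
Definition ffun_meet f g : {ffun T -> R^o} :=
  [ffun x => Num.min (f x : R) (g x)].
Definition ffun_join f g : {ffun T -> R^o} :=
  [ffun x => Num.max (f x : R) (g x)].

Let ffun_lt_def f g : ffun_lt f g = (g != f) && ffun_le f g.
Proof. by []. Qed.

Let ffun_le_refl : reflexive ffun_le.
Proof. by move=> f; apply/forallP. Qed.

Let ffun_le_anti : antisymmetric ffun_le.
Proof.
move=> f g /andP[/forallP fg /forallP gf]; apply/ffunP => x.
by apply: (@le_anti _ R); rewrite fg gf.
Qed.

Let ffun_le_trans : transitive ffun_le.
Proof.
move=> g f h /forallP fg /forallP gh; apply/forallP => x.
exact: le_trans (fg x) (gh x).
Qed.

HB.instance Definition _ := Order.isPOrder.Build ring_display {ffun T -> R^o}
  ffun_lt_def ffun_le_refl ffun_le_anti ffun_le_trans.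

Let ffun_lexI f g h : (h <= ffun_meet f g) = (h <= f) && (h <= g).
Proof.
apply/forallP/andP => [hfg|[/forallP hf /forallP hg] x].
  by split; apply/forallP => x; move: (hfg x); rewrite ffunE le_min => /andP[].
by rewrite ffunE le_min hf hg.
Qed.

Let ffun_leUx f g h : (ffun_join f g <= h) = (f <= h) && (g <= h).
Proof.
apply/forallP/andP => [fgh|[/forallP fh /forallP gh] x].
  by split; apply/forallP => x; move: (fgh x); rewrite ffunE ge_max => /andP[].
by rewrite ffunE ge_max fh gh.
Qed.

Let ffun_leD2r f g h : f <= g -> f + h <= g + h.
Proof.
by move=> /forallP fg; apply/forallP => x; rewrite !ffunE lerD2r.
Qed.

Let ffun_scale_ge0 (a : R) f : 0 <= a -> 0 <= f -> 0 <= a *: f.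
Proof.
move=> a0 /forallP f0; apply/forallP => x; move: (f0 x); rewrite !ffunE.
exact: mulr_ge0.
Qed.

HB.instance Definition _ :=
  POrderedLmodule_isRiesz.Build R {ffun T -> R^o}
    ffun_lexI ffun_leUx ffun_leD2r ffun_scale_ge0.

End FunctionRiesz.

Section CanonicalRepresentation.
Context (R : realType) (gT : finGroupType) (H : {group gT}).

(* G/H as the set of left cosets tH; H is not assumed normal, so this is not
   the library's quotient group. *)
Definition coset_space := {A : {set gT} | A \in lcosets H [set: gT]%SET}.

Lemma coset_of_subproof (t : gT) : (t *: H)%g \in lcosets H [set: gT]%SET.
Proof. by apply/lcosetsP; exists t; rewrite ?inE. Qed.

Definition coset_elt (t : gT) : coset_space :=
  Sub (t *: H)%g (coset_of_subproof t).

Lemma coset_act_subproof (s : gT) (A : coset_space) :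
  (s *: val A)%g \in lcosets H [set: gT]%SET.
Proof.
case: A => A /= /lcosetsP[t _ ->]; apply/lcosetsP; exists (s * t)%g => //.
by rewrite lcosetM.
Qed.

Definition coset_act (s : gT) (A : coset_space) : coset_space :=
  Sub (s *: val A)%g (coset_act_subproof s A).

Definition coset_basis (A : coset_space) : {ffun coset_space -> R^o} :=
  [ffun B => (A == B)%:R].

(* The linear extension of e_A |-> e_{sA}. *)
Definition canonical_act (s : gT) (f : {ffun coset_space -> R^o}) :
    {ffun coset_space -> R^o} :=
  \sum_(A : coset_space) (f A : R) *: coset_basis (coset_act s A).

Lemma coset_act1 A : coset_act 1 A = A.
Proof. by apply: val_inj; rewrite /= lcoset1. Qed.

Lemma coset_actM s t A : coset_act (s * t) A = coset_act s (coset_act t A).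
Proof. by apply: val_inj; rewrite /= lcosetM. Qed.

Lemma coset_actK s : cancel (coset_act s) (coset_act s^-1).
Proof. by move=> A; rewrite -coset_actM mulVg coset_act1. Qed.

Lemma coset_actKV s : cancel (coset_act s^-1) (coset_act s).
Proof. by move=> A; rewrite -coset_actM mulgV coset_act1. Qed.

Lemma canonical_actE s f B : canonical_act s f B = f (coset_act s^-1 B).
Proof.
rewrite /canonical_act sum_ffunE.
transitivity (\sum_(A : coset_space) f A * (coset_act s A == B)%:R : R).
  by apply: eq_bigr => A _; rewrite !ffunE.
rewrite (bigD1 (coset_act s^-1 B)) //= coset_actKV eqxx mulr1.
rewrite big1 ?addr0 // => A neqA.
rewrite (_ : _ == B = false) ?mulr0 //; apply: contra_neqF neqA => /eqP <-.
by rewrite coset_actK.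
Qed.

Lemma canonical_act_basis s t :
  canonical_act s (coset_basis (coset_elt t)) =
  coset_basis (coset_elt (s * t)).
Proof.
apply/ffunP => B; rewrite canonical_actE !ffunE; congr (_%:R).
have -> : coset_elt (s * t) = coset_act s (coset_elt t).
  by apply: val_inj; rewrite /= lcosetM.
by rewrite -(can_eq (coset_actK s)) coset_actKV.
Qed.

Lemma canonical_act_linear s : linear (canonical_act s).
Proof. by move=> a f g; apply/ffunP => B; rewrite !(canonical_actE, ffunE). Qed.

HB.instance Definition _ s :=
  GRing.isLinear.Build R {ffun coset_space -> R^o} {ffun coset_space -> R^o} _
    (canonical_act s) (canonical_act_linear s).

Lemma canonical_actM s t f :
  canonical_act (s * t) f = canonical_act s (canonical_act t f).
Proof.
by apply/ffunP => B; rewrite !canonical_actE invMg coset_actM.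
Qed.

Definition coset_riesz : rieszType R := {ffun coset_space -> R^o}.

Lemma canonical_act_aut s :
  @lattice_isomorphism R coset_riesz coset_riesz (canonical_act s).
Proof.
split.
- exists (canonical_act s^-1) => f; apply/ffunP => B; rewrite !canonical_actE.
    by rewrite -coset_actM mulgV coset_act1.
  by rewrite -coset_actM mulVg coset_act1.
- by move=> f g; apply/ffunP => B; rewrite !(canonical_actE, ffunE).
- by move=> f g; apply/ffunP => B; rewrite !(canonical_actE, ffunE).
Qed.

Definition canonical_rep : posrep R gT :=
  @PosRep R gT coset_riesz (fun s => canonical_act s)
    canonical_act_aut canonical_actM.

End CanonicalRepresentation.

Arguments canonical_rep R {gT} H.

Section Classes.
Context (R : realType) (gT : finGroupType).

Definition conjugacy_class (H : {group gT}) : {set {set gT}} :=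
  (H :^: [set: gT]%SET)%g.

Definition subgroup_classes :=
  {C : {set {set gT}} | exists H : {group gT}, C = conjugacy_class H}.

Definition class_of_subgroup (H : {group gT}) : subgroup_classes :=
  exist _ (conjugacy_class H) (ex_intro _ H erefl).

Definition irreducible_order_classes :=
  {c : posrep R gT -> Prop |
    exists rho, irreducible_fd_archimedean rho /\ c = order_class rho}.

End Classes.

(* Main.v *)
(* Disjoint positive vectors are linearly independent, so in finite dimension
   some positive vector [e] cannot be split into disjoint parts; in the
   Archimedean case such an [e] is an atom, i.e. its order interval consists of
   multiples of [e].  Two translates of an atom [a] under the representation are
   disjoint or proportional, and in the latter case equal because the group is
   finite; so the orbit of [a] is a disjoint family indexed by [G/H], with [H]
   the stabiliser of [a].  The disjoint complement of the orbit is an invariant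
   band not containing [a], hence zero by irreducibility; subtracting from
   [x >= 0] its largest multiples of the orbit vectors therefore leaves nothing,
   and [e_(tH) |-> rho_t a] is an order equivalence from [C(G/H)].  Conversely the
   atoms of [C(G/H)] are the positive multiples of the [e_(tH)], whose stabilisers
   are the conjugates of [H], so [H] is determined up to conjugacy. *)
From HB Require Import structures.
Require Import Defs.
From mathcomp Require Import all_boot all_order all_algebra all_fingroup.
From mathcomp Require Import all_classical all_reals.

Set Implicit Arguments.
Unset Strict Implicit.
Unset Printing Implicit Defensive.

Import Order.TTheory GRing.Theory Num.Theory.

Local Open Scope classical_set_scope.
Local Open Scope ring_scope.

(** * Riesz spaces and disjointness *)

Section RieszTheory.
Context (R : realType) (E : rieszType R).
Implicit Types (x y z u v w e : E) (a b c : R).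

Lemma riesz_leD2rE z x y : (x + z <= y + z) = (x <= y).
Proof.
apply/idP/idP => [xy|]; last exact: riesz_leD2r.
by rewrite -(addrK z x) -(addrK z y); exact: riesz_leD2r.
Qed.

Lemma riesz_subr_ge0 x y : (0 <= y - x) = (x <= y).
Proof. by rewrite -(riesz_leD2rE x 0) add0r subrK. Qed.

Lemma riesz_leBlDr x y z : (x - y <= z) = (x <= z + y).
Proof. by rewrite -(riesz_leD2rE y (x - y)) subrK. Qed.

Lemma riesz_leBrDr x y z : (x <= y - z) = (x + z <= y).
Proof. by rewrite -(riesz_leD2rE z x) subrK. Qed.

Lemma riesz_oppr_ge0 x : (0 <= - x) = (x <= 0).
Proof. by rewrite -{1}[- x]add0r riesz_subr_ge0. Qed.

Lemma riesz_lerN x y : (- x <= - y) = (y <= x).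
Proof. by rewrite -(riesz_subr_ge0 (- x)) opprK addrC riesz_subr_ge0. Qed.

Lemma riesz_leD x y u v : x <= y -> u <= v -> x + u <= y + v.
Proof.
move=> xy uv; apply: (@le_trans _ _ (y + u)); first by rewrite riesz_leD2rE.
by rewrite ![y + _]addrC riesz_leD2rE.
Qed.

Lemma riesz_addr_ge0 x y : 0 <= x -> 0 <= y -> 0 <= x + y.
Proof. by move=> x0 y0; rewrite -[0]addr0; exact: riesz_leD. Qed.

Lemma riesz_sumr_ge0 (I : Type) (r : seq I) (P : pred I) (u : I -> E) :
  (forall i, P i -> 0 <= u i) -> 0 <= \sum_(i <- r | P i) u i.
Proof. by move=> u0; apply: (big_ind (fun x => 0 <= x)) => //; exact: riesz_addr_ge0. Qed.

Lemma riesz_ler_sum (I : Type) (r : seq I) (P : pred I) (u v : I -> E) :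
  (forall i, P i -> u i <= v i) ->
  \sum_(i <- r | P i) u i <= \sum_(i <- r | P i) v i.
Proof. by move=> uv; apply: (big_ind2 (fun x y => x <= y)) => // *; exact: riesz_leD. Qed.

Lemma riesz_lerZ a x y : 0 <= a -> x <= y -> a *: x <= a *: y.
Proof.
move=> a0; rewrite -riesz_subr_ge0 => xy.
by rewrite -riesz_subr_ge0 -scalerBr; exact: riesz_scale_ge0.
Qed.

Lemma riesz_lerZl a b x : 0 <= x -> a <= b -> a *: x <= b *: x.
Proof.
move=> x0 ab; rewrite -riesz_subr_ge0 -scalerBl.
by apply: riesz_scale_ge0; rewrite ?subr_ge0.
Qed.

Lemma riesz_scaler_ge0E a x : 0 < x -> (0 <= a *: x) = (0 <= a).
Proof.
move=> x0; apply/idP/idP => [ax|a0]; last exact/riesz_scale_ge0/ltW.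
rewrite leNgt; apply/negP => a0.
have : 0 <= (- a)^-1 *: (a *: x).
  by apply: riesz_scale_ge0 => //; rewrite invr_ge0 oppr_ge0 ltW.
rewrite scalerA invrN mulNr mulVf ?lt_eqF//. rewrite scaleNr scale1r riesz_oppr_ge0.
by move=> /(lt_le_trans x0); rewrite ltxx.
Qed.

Lemma riesz_leIl x y : riesz_meet x y <= x.
Proof. by have := lexx (riesz_meet x y); rewrite riesz_lexI => /andP[]. Qed.

Lemma riesz_leIr x y : riesz_meet x y <= y.
Proof. by have := lexx (riesz_meet x y); rewrite riesz_lexI => /andP[]. Qed.

Lemma riesz_leUl x y : x <= riesz_join x y.
Proof. by have := lexx (riesz_join x y); rewrite riesz_leUx => /andP[]. Qed.

Lemma riesz_leUr x y : y <= riesz_join x y.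
Proof. by have := lexx (riesz_join x y); rewrite riesz_leUx => /andP[]. Qed.

Lemma riesz_eq_meetl x y : (x == riesz_meet x y) = (x <= y).
Proof. by rewrite eq_le riesz_lexI lexx riesz_leIl andbT. Qed.

Lemma riesz_abs_ge0 x : 0 <= riesz_abs x.
Proof.
have h : 0 <= (2%:R : R) *: riesz_abs x.
  rewrite scaler_nat mulr2n -(subrr x).
  by apply: riesz_leD; [exact: riesz_leUl|exact: riesz_leUr].
rewrite -[riesz_abs x]scale1r -(@mulVf _ 2%:R) ?pnatr_eq0// -scalerA.
by apply: riesz_scale_ge0; rewrite ?invr_ge0 ?ler0n.
Qed.

Definition riesz_pos x := riesz_join x 0.

Lemma riesz_pos_ge0 x : 0 <= riesz_pos x. Proof. exact: riesz_leUr. Qed.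

Lemma riesz_pos_ge x : x <= riesz_pos x. Proof. exact: riesz_leUl. Qed.

Lemma riesz_pos_le x y : x <= y -> 0 <= y -> riesz_pos x <= y.
Proof. by move=> xy y0; rewrite riesz_leUx xy. Qed.

Lemma riesz_pos_homo x y : x <= y -> riesz_pos x <= riesz_pos y.
Proof.
by move=> xy; apply: riesz_pos_le (riesz_pos_ge0 _); exact: le_trans (riesz_pos_ge _).
Qed.

Lemma riesz_pos_eq0 x : riesz_pos x = 0 -> x <= 0.
Proof. by move=> <-; exact: riesz_pos_ge. Qed.

Lemma riesz_posN x : riesz_pos (- x) = riesz_pos x - x.
Proof.
apply/le_anti/andP; split.
  by rewrite riesz_leUx riesz_leBrDr addNr riesz_pos_ge0 riesz_subr_ge0 riesz_pos_ge.
rewrite riesz_leBlDr riesz_leUx; apply/andP; split; rewrite -riesz_leBlDr.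
  by rewrite subrr riesz_pos_ge0.
by rewrite sub0r riesz_pos_ge.
Qed.

Lemma riesz_posB x : x = riesz_pos x - riesz_pos (- x).
Proof. by rewrite riesz_posN opprB addrC subrK. Qed.

Lemma riesz_pos_abs x : riesz_pos x <= riesz_abs x.
Proof. by apply: riesz_pos_le; [exact: riesz_leUl|exact: riesz_abs_ge0]. Qed.

Lemma riesz_absN x : riesz_abs (- x) = riesz_abs x.
Proof.
by apply/le_anti; rewrite /riesz_abs !riesz_leUx opprK !(riesz_leUl, riesz_leUr).
Qed.

Lemma riesz_posN_abs x : riesz_pos (- x) <= riesz_abs x.
Proof. by rewrite -riesz_absN; exact: riesz_pos_abs. Qed.

Lemma riesz_abs_le x y : x <= y -> - x <= y -> riesz_abs x <= y.
Proof. by move=> xy nxy; rewrite riesz_leUx xy. Qed.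

Lemma riesz_absE x : riesz_abs x <= riesz_pos x + riesz_pos (- x).
Proof.
apply: riesz_abs_le.
  by rewrite -[leLHS]addr0; apply: riesz_leD (riesz_pos_ge _) (riesz_pos_ge0 _).
by rewrite -[leLHS]add0r; apply: riesz_leD (riesz_pos_ge0 _) (riesz_pos_ge _).
Qed.

Lemma riesz_ger0_abs x : 0 <= x -> riesz_abs x = x.
Proof.
move=> x0; apply/le_anti; rewrite riesz_leUl riesz_leUx lexx !andbT /=.
by rewrite (le_trans _ x0)// -riesz_oppr_ge0 opprK.
Qed.

(* For nonnegative [x] and [y] this says that their meet is [0]; stating it as
   an inequality makes it monotone in each argument without sign conditions. *)
Definition riesz_disjoint x y := riesz_meet x y <= 0.

Lemma riesz_disjointP x y :
  reflect (forall z, z <= x -> z <= y -> z <= 0) (riesz_disjoint x y).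
Proof.
apply: (iffP idP) => [xy z zx zy|]; last by apply; rewrite ?riesz_leIl ?riesz_leIr.
by apply: le_trans xy; rewrite riesz_lexI zx.
Qed.

Lemma riesz_disjointC x y : riesz_disjoint x y = riesz_disjoint y x.
Proof.
by apply/riesz_disjointP/riesz_disjointP => xy z zx zy; exact: xy.
Qed.

Lemma riesz_disjoint_le x y u v :
  u <= x -> v <= y -> riesz_disjoint x y -> riesz_disjoint u v.
Proof.
move=> ux vy /riesz_disjointP xy; apply/riesz_disjointP => z zu zv.
by apply: xy; [exact: le_trans ux|exact: le_trans vy].
Qed.

Lemma riesz_disjoint_lel x y u :
  u <= x -> riesz_disjoint x y -> riesz_disjoint u y.
Proof. by move=> ux; exact: riesz_disjoint_le. Qed.

(** If [t] is below [x + y] and [z], then [t - y] is below [x] and [z], so [t <= y]; being also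
    below [z], [t] is nonpositive. *)
Lemma riesz_disjointD x y z : 0 <= y ->
  riesz_disjoint x z -> riesz_disjoint y z -> riesz_disjoint (x + y) z.
Proof.
move=> y0 /riesz_disjointP xz /riesz_disjointP yz; apply/riesz_disjointP => t txy tz.
apply: yz => //; rewrite -[t](subrK y) -[leRHS]add0r riesz_leD2rE.
apply: xz; rewrite riesz_leBlDr //.
by rewrite -[t]addr0; exact: riesz_leD.
Qed.

Lemma riesz_disjoint0 x : riesz_disjoint 0 x.
Proof. exact: riesz_leIl. Qed.

Lemma riesz_disjoint_self x : riesz_disjoint x x -> x <= 0.
Proof. by move/riesz_disjointP; apply. Qed.

Lemma riesz_disjoint_sum (I : Type) (r : seq I) (P : pred I) (u : I -> E) z :
  (forall i, P i -> 0 <= u i) -> (forall i, P i -> riesz_disjoint (u i) z) ->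
  riesz_disjoint (\sum_(i <- r | P i) u i) z.
Proof.
move=> u0 uz.
suff /andP[] : (0 <= \sum_(i <- r | P i) u i) &&
  riesz_disjoint (\sum_(i <- r | P i) u i) z by [].
apply: (big_ind (fun x => (0 <= x) && riesz_disjoint x z)).
- by rewrite lexx riesz_disjoint0.
- move=> x y /andP[x0 xz] /andP[y0 yz].
  by rewrite riesz_addr_ge0//= riesz_disjointD.
- by move=> i Pi; rewrite u0 ?uz.
Qed.

(** [a *: x] lies below a sum of [n] copies of [x] for an integer [n >= a]. *)
Lemma riesz_disjointZ a x y : 0 <= a -> 0 <= x ->
  riesz_disjoint x y -> riesz_disjoint (a *: x) y.
Proof.
move=> a0 x0 xy; have [n an] : exists n : nat, a <= n%:R.
  by exists (Num.truncn a).+1; exact/ltW/truncnS_gt.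
apply: (@riesz_disjoint_lel (\sum_(i < n) x)); last exact: riesz_disjoint_sum.
by rewrite sumr_const card_ord -scaler_nat; exact: riesz_lerZl.
Qed.

(** [x + y - z] is a lower bound of both [x] and [y]. *)
Lemma riesz_disjoint_leD x y z :
  riesz_disjoint x y -> x <= z -> y <= z -> x + y <= z.
Proof.
move=> /riesz_disjointP xy xz yz; rewrite -[z]add0r -riesz_leBlDr.
by apply: xy; rewrite riesz_leBlDr; [|rewrite [x + y]addrC]; rewrite riesz_leD.
Qed.

Lemma riesz_disjoint_sum_le (I : eqType) (r : seq I) (u : I -> E) z : uniq r ->
  (forall i, 0 <= u i) -> (forall i j, i != j -> riesz_disjoint (u i) (u j)) ->
  0 <= z -> (forall i, u i <= z) -> \sum_(i <- r) u i <= z.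
Proof.
move=> + u0 uu z0 uz; elim: r => [|i r IH] /=; first by rewrite big_nil.
move=> /andP[ir ur]; rewrite big_cons riesz_disjoint_leD ?IH// riesz_disjointC.
rewrite big_seq riesz_disjoint_sum // => j jr; apply: uu.
by apply: contraNneq ir => <-.
Qed.

(** If [z] is below both parts, then [riesz_pos x - z] bounds [x] and [0] from above, hence also
    [riesz_pos x]. *)
Lemma riesz_disjoint_pos x : riesz_disjoint (riesz_pos x) (riesz_pos (- x)).
Proof.
apply/riesz_disjointP => z zx; rewrite riesz_posN => znx.
rewrite -(riesz_leD2rE (riesz_pos x)) add0r addrC -riesz_leBrDr.
rewrite riesz_pos_le//; last by rewrite riesz_leBrDr add0r.
by rewrite riesz_leBrDr addrC -riesz_leBrDr.
Qed.

(** If [c i < 0], the positive vector [- c i *: u i] is dominated by a combination of the other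
    [u j], from which it is disjoint; so it is disjoint from itself. *)
Lemma riesz_disjoint_family_ge0 (I : finType) (u : I -> E) (c : I -> R) :
  (forall i, 0 < u i) -> (forall i j, i != j -> riesz_disjoint (u i) (u j)) ->
  0 <= \sum_i c i *: u i -> forall i, 0 <= c i.
Proof.
move=> u0 uu s0 i; rewrite leNgt; apply/negP => ci0.
have u0' j : 0 <= u j by exact/ltW.
have le_rest : - c i *: u i <= \sum_(j | j != i) `|c j| *: u j.
  rewrite scaleNr -sub0r riesz_leBlDr addrC (le_trans s0)// (bigD1 i)//=.
  rewrite riesz_leD// riesz_ler_sum// => j _.
  by rewrite riesz_lerZl ?ler_norm.
have : riesz_disjoint (- c i *: u i) (- c i *: u i).
  apply: riesz_disjoint_lel le_rest _.
  apply: riesz_disjoint_sum => [j _|j ji]; first exact: riesz_scale_ge0.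
  apply: riesz_disjointZ => //; rewrite riesz_disjointC.
  by apply: riesz_disjointZ; rewrite ?oppr_ge0 ?ltW// uu// eq_sym.
move/riesz_disjoint_self; rewrite scaleNr -riesz_oppr_ge0 opprK.
by rewrite riesz_scaler_ge0E// leNgt ci0.
Qed.

Lemma riesz_disjoint_family_free (I : finType) (u : I -> E) (c : I -> R) :
  (forall i, 0 < u i) -> (forall i j, i != j -> riesz_disjoint (u i) (u j)) ->
  \sum_i c i *: u i = 0 -> forall i, c i = 0.
Proof.
move=> u0 uu s0 i; apply/le_anti.
rewrite (riesz_disjoint_family_ge0 u0 uu) ?s0// andbT -oppr_ge0.
apply: (riesz_disjoint_family_ge0 u0 uu (c := fun i => - c i)).
rewrite (eq_bigr (fun j => - (c j *: u j))) => [|j _]; last exact: scaleNr.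
by rewrite sumrN s0 oppr0.
Qed.

End RieszTheory.

(** * Atoms *)

Section Atoms.
Context (R : realType) (E : rieszType R).
Implicit Types (x y z u v w e : E) (a b c : R).

Definition riesz_atom e :=
  0 < e /\ forall x, 0 <= x -> x <= e -> exists c, x = c *: e.

(** The meet is a multiple of each atom, and its coefficient on [u] is nonzero when they are not
    disjoint. *)
Lemma riesz_atom_disjoint u v : riesz_atom u -> riesz_atom v ->
  ~~ riesz_disjoint u v -> exists2 c, 0 <= c & u = c *: v.
Proof.
move=> [u0 au] [v0 av] nuv; set m := riesz_meet u v.
have m0 : 0 <= m by rewrite riesz_lexI !ltW.
have [c mc] := au m m0 (riesz_leIl _ _).
have [d md] := av m m0 (riesz_leIr _ _).
have c0 : c != 0.
  by apply: contraNneq nuv => c0; rewrite /riesz_disjoint -/m mc c0 scale0r.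
have ucd : u = (c^-1 * d) *: v.
  by rewrite -scalerA -md mc scalerA mulVf ?scale1r.
exists (c^-1 * d) => //.
by rewrite -(riesz_scaler_ge0E _ v0) -ucd ltW.
Qed.

Lemma archimedean_le0 x y : archimedean E -> 0 <= y ->
  (forall n, x <= n.+1%:R^-1 *: y) -> x <= 0.
Proof.
move=> arch y0 xy; apply: riesz_pos_eq0; apply: (arch _ y).
  exact: riesz_pos_ge0.
case=> [//|n]; rewrite -scaler_nat -[leRHS](scalerKV (a := n.+1%:R)) ?pnatr_eq0//.
rewrite riesz_lerZ// riesz_pos_le//.
by rewrite riesz_scale_ge0// invr_ge0.
Qed.

Lemma archimedean_max_scale e x : archimedean E -> 0 < e -> 0 <= x ->
  exists d, [/\ 0 <= d, d *: e <= x & forall c, c *: e <= x -> c <= d].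
Proof.
move=> arch e0 x0; pose S := [set c | c *: e <= x].
have S0 : S 0 by rewrite /S/= scale0r.
have supS : has_sup S.
  split; first by exists 0.
  (* Were [S] unbounded, every multiple of [e] would lie below [x], forcing [e = 0]. *)
  apply: contrapT => nub.
  suff e00 : e = 0 by move: e0; rewrite e00 ltxx.
  apply: (arch _ x); first exact: ltW.
  move=> n; apply: contrapT => nx; apply: nub; exists n%:R => c /= cx.
  rewrite leNgt; apply/negP => /ltW nc; apply: nx.
  by rewrite -scaler_nat (le_trans _ cx)// riesz_lerZl// ltW.
exists (sup S); split.
- exact: sup_upper_bound.
(* The supremum is attained: [sup S *: e - x] lies below every [n.+1%:R^-1 *: e]. *)
- rewrite -[x]add0r -riesz_leBlDr.
  apply: (archimedean_le0 arch (ltW e0)) => n.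
  have n0 : (0 : R) < n.+1%:R^-1 by rewrite invr_gt0.
  have [c Sc dc] := sup_adherent n0 supS.
  rewrite riesz_leBlDr (le_trans (y := (n.+1%:R^-1 + c) *: e))//.
    by rewrite riesz_lerZl ?(ltW e0)// -lerBlDl ltW.
  by rewrite scalerDl riesz_leD.
- by move=> c cx; exact: sup_upper_bound.
Qed.

(** For the maximal [d], the meet of the remainder with [e] is some [c *: e]; then
    [(c + d) *: e <= x], so [c <= 0]. *)
Lemma riesz_atom_remainder e x : archimedean E -> riesz_atom e -> 0 <= x ->
  exists d, [/\ 0 <= d, d *: e <= x & riesz_disjoint (x - d *: e) e].
Proof.
move=> arch [e0 ae] x0.
have [d [d0 dx dmax]] := archimedean_max_scale arch e0 x0.
exists d; split=> //; rewrite /riesz_disjoint.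
have m0 : 0 <= riesz_meet (x - d *: e) e.
  by rewrite riesz_lexI riesz_subr_ge0 dx ltW.
have [c mc] := ae _ m0 (riesz_leIr _ _).
have := riesz_leIl (x - d *: e) e.
rewrite mc riesz_leBrDr -scalerDl => /dmax.
rewrite -lerBrDr subrr => c0.
by rewrite -riesz_oppr_ge0 -scaleNr riesz_scaler_ge0E// oppr_ge0.
Qed.

(* For [w] the remainder of [x] after its largest multiple of [e] and
   [0 < t <= 1], the parts [(w - t e)^+] and [(t e - w)^+] are disjoint and
   below [e], so one vanishes; hence [w <= t e] for all such [t]. *)
Lemma indecomposable_atom e : archimedean E -> 0 < e ->
  (forall u v, 0 <= u -> 0 <= v -> u <= e -> v <= e -> riesz_disjoint u v ->
     u = 0 \/ v = 0) ->
  riesz_atom e.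
Proof.
move=> arch e0 ind; split=> // x x0 xe.
have [d [d0 dx dmax]] := archimedean_max_scale arch e0 x0.
exists d; apply/eqP; rewrite eq_le dx andbT -[leRHS]add0r -riesz_leBlDr.
set w := x - d *: e; have w0 : 0 <= w by rewrite riesz_subr_ge0.
have we : w <= e.
  rewrite (le_trans _ xe)// riesz_leBlDr -[leLHS]addr0 riesz_leD//.
  exact: riesz_scale_ge0 d0 (ltW e0).
apply: (archimedean_le0 arch (ltW e0)) => n; set t := n.+1%:R^-1.
have t0 : 0 < t by rewrite invr_gt0.
have te0 : 0 <= t *: e by rewrite riesz_scale_ge0// ltW.
have te : t *: e <= e.
  by rewrite -[leRHS]scale1r riesz_lerZl// ?(ltW e0)// invf_le1 ?ler1n.
case: (ind _ _ (riesz_pos_ge0 (w - t *: e)) (riesz_pos_ge0 (- (w - t *: e)))).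
- by rewrite riesz_pos_le ?(ltW e0)// riesz_leBlDr -[leLHS]addr0 riesz_leD.
- by rewrite riesz_pos_le ?(ltW e0)// opprB riesz_leBlDr -[leLHS]addr0 riesz_leD.
- exact: riesz_disjoint_pos.
- by move/riesz_pos_eq0; rewrite riesz_leBlDr add0r.
(* Here [t *: e <= w], so [(t + d) *: e <= x] against the maximality of [d]. *)
- move/riesz_pos_eq0; rewrite opprB riesz_leBlDr add0r riesz_leBrDr -scalerDl.
  by move/dmax; rewrite -lerBrDr subrr leNgt t0.
Qed.

(** The coordinates of the [u j] form a [k] by [n] matrix; a row vector killing it gives a vanishing
    combination of the [u j], hence is zero. *)
Lemma disjoint_family_size n (b : 'I_n -> E) k (u : 'I_k -> E) :
  (forall x, exists c : 'I_n -> R, x = \sum_(i < n) c i *: b i) ->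
  (forall i, 0 < u i) -> (forall i j, i != j -> riesz_disjoint (u i) (u j)) ->
  (k <= n)%N.
Proof.
move=> gen u0 uu; have [c uc] := choice (fun j => gen (u j)).
pose C : 'M[R]_(k, n) := \matrix_(j, i) c j i.
have : row_free C.
  rewrite -kermx_eq0 -submx0; apply/rV_subP => v /sub_kermxP vC.
  suff -> : v = 0 by rewrite sub0mx.
  apply/rowP => j; rewrite mxE.
  apply: (riesz_disjoint_family_free u0 uu (c := v 0)).
  under eq_bigr do rewrite uc scaler_sumr.
  rewrite exchange_big/= big1// => i _.
  under eq_bigr do rewrite scalerA.
  have /matrixP/(_ 0 i) := vC; rewrite !mxE => vci.
  rewrite -scaler_suml (_ : \sum_j _ = 0) ?scale0r// -[RHS]vci.
  by apply: eq_bigr => l _; rewrite mxE.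
by move/eqP <-; exact: rank_leq_col.
Qed.

Lemma fd_archimedean_atom : archimedean E -> finite_dimensional E ->
  nonzero_space E -> exists e, riesz_atom e.
Proof.
move=> arch [n [b gen]] [x0 /eqP nx0].
have [e e0] : exists e, 0 < e.
  apply: contrapT => ne; move/negP: nx0; apply; apply/eqP.
  have p0 y : riesz_pos y = 0.
    apply/eqP/negPn/negP => py; apply: ne; exists (riesz_pos y).
    by rewrite lt_def py riesz_pos_ge0.
  by rewrite (riesz_posB x0) !p0 subr0.
apply: contrapT => noatom; suff: (n < n)%N by rewrite ltnn.
(* Keeping the family below [e] is what makes the induction work: a family built below one half of a
   splitting stays disjoint from the other half. *)
suff [u [u0 _ uu]] : exists u : nat -> E, [/\
    forall i, (i < n.+1)%N -> 0 < u i, forall i, (i < n.+1)%N -> u i <= e &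
    forall i j, (i < j < n.+1)%N -> riesz_disjoint (u i) (u j)].
  apply: (disjoint_family_size (u := fun i : 'I_n.+1 => u i) gen) => [i|i j ij].
    exact: u0.
    have : (i < j)%N || (j < i)%N by rewrite -neq_ltn.
  case/orP => ltij; first by apply: uu; rewrite ltij ltn_ord.
  by rewrite riesz_disjointC; apply: uu; rewrite ltij ltn_ord.
elim: n.+1 e e0 {gen b} => [|k IH] e e0; first by exists (fun=> e); split=> // i j; rewrite andbF.
have [x [y [xp yp xe ye xy]]] : exists x y,
    [/\ 0 < x, 0 < y, x <= e, y <= e & riesz_disjoint x y].
  apply: contrapT => nxy; apply: noatom; exists e.
  apply: indecomposable_atom => // u v u0 v0 ue ve uv.
  apply: contrapT => /not_orP[/eqP un0 /eqP vn0]; apply: nxy.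
  by exists u, v; split; rewrite // lt_def ?un0 ?vn0.
have [u [u0 ux uu]] := IH x xp.
(* The half [y] takes index 0, and the family found below [x] is shifted by one. *)
exists (fun i => if i is j.+1 then u j else y); split.
- by case.
- by case=> // i ik; rewrite (le_trans (ux i ik)).
- move=> [|i] [|j]//= => [jk|/uu//].
  by rewrite riesz_disjointC; apply: riesz_disjoint_lel xy; exact: ux.
Qed.

End Atoms.

(** * Lattice isomorphisms and disjoint complements *)

Section LatticeIsomorphisms.
Context (R : realType) (E F : rieszType R).
Implicit Type T : {linear E -> F}.

Lemma lattice_isomorphism_le T : lattice_isomorphism T ->
  {mono T : x y / x <= y}.
Proof.
by case=> /bij_inj injT TI _ x y; rewrite -!riesz_eq_meetl -TI inj_eq.
Qed.

Lemma order_isomorphism_lattice T : bijective T ->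
  {mono T : x y / x <= y} -> lattice_isomorphism T.
Proof.
move=> bijT leT; split=> // x y; have [g Tg gT] := bijT.
- apply/le_anti; rewrite riesz_lexI !leT riesz_leIl riesz_leIr /=.
  by rewrite -[leLHS]gT leT riesz_lexI -!leT gT riesz_leIl riesz_leIr.
- apply/le_anti; rewrite riesz_leUx !leT riesz_leUl riesz_leUr andbT.
  by rewrite -[leRHS]gT leT riesz_leUx -!leT gT riesz_leUl riesz_leUr.
Qed.

Lemma lattice_isomorphism_disjoint T : lattice_isomorphism T ->
  {mono T : x y / riesz_disjoint x y}.
Proof.
move=> isoT x y; have [_ TI _] := isoT.
by rewrite /riesz_disjoint -TI -(raddf0 T) lattice_isomorphism_le.
Qed.

Lemma lattice_isomorphism_abs T : lattice_isomorphism T ->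
  {morph T : x / riesz_abs x}.
Proof. by move=> [_ _ TU] x; rewrite /riesz_abs TU raddfN. Qed.

End LatticeIsomorphisms.

Lemma lattice_isomorphism_inv (R : realType) (E F : rieszType R)
    (T : {linear E -> F}) : lattice_isomorphism T ->
  exists T' : {linear F -> E},
    [/\ lattice_isomorphism T', cancel T T' & cancel T' T].
Proof.
move=> isoT; have [[g Tg gT] _ _] := isoT.
have g_lin : linear g by move=> a x y; rewrite -[RHS]Tg linearP !gT.
pose T' : {linear F -> E} := HB.pack g (GRing.isLinear.Build R F E _ g g_lin).
exists T'; split=> //; apply: order_isomorphism_lattice; first by exists T.
by move=> x y; rewrite -(lattice_isomorphism_le isoT) /= !gT.
Qed.

Lemma lattice_isomorphism_atom (R : realType) (E F : rieszType R)
    (T : {linear E -> F}) e : lattice_isomorphism T ->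
  riesz_atom e -> riesz_atom (T e).
Proof.
move=> isoT [e0 ae]; have [T' [_ TT' T'T]] := lattice_isomorphism_inv isoT.
have leT := lattice_isomorphism_le isoT; split.
  rewrite lt_def -(raddf0 T) leT ltW// (can_eq TT') andbT.
  by move: e0; rewrite lt_def => /andP[].
move=> x; rewrite -[x]T'T -[X in X <= _](raddf0 T) !leT => x0 xe.
by have [c ->] := ae _ x0 xe; exists c; rewrite linearZ.
Qed.

Section DisjointComplement.
Context (R : realType) (E : rieszType R).
Implicit Types (x y : E) (A : set E).

Lemma riesz_scale_le_abs (a : R) x : a *: x <= `|a| *: riesz_abs x.
Proof.
have [a0|a0] := leP 0 a; first by rewrite ger0_norm// riesz_lerZ// riesz_leUl.
rewrite ltr0_norm// -[a in leLHS]opprK scaleNr -scalerN riesz_lerZ ?riesz_leUr//.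
by rewrite oppr_ge0 ltW.
Qed.

Lemma riesz_abs_linear (a : R) x y :
  riesz_abs (a *: x + y) <= `|a| *: riesz_abs x + riesz_abs y.
Proof.
apply: riesz_abs_le.
  by rewrite riesz_leD ?riesz_scale_le_abs ?riesz_leUl.
by rewrite opprD -scaleNr -[`|a|]normrN riesz_leD ?riesz_scale_le_abs ?riesz_leUr.
Qed.

Definition disjoint_complement A : set E :=
  [set x | forall a, A a -> riesz_disjoint (riesz_abs x) a].

(** The delicate point is closure under suprema. The negative part of [y] is below that of any
    member of [D]. For the positive part, [z] is disjoint from the positive part of each member of
    [D], so subtracting [z] from [y] costs nothing, whence [z <= 0]. *)
Lemma disjoint_complement_band A : band (disjoint_complement A).
Proof.
split; [split; [split|]|].
- by move=> a _; rewrite riesz_ger0_abs ?lexx// riesz_disjoint0.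
- move=> c x y Bx By a Aa; apply: riesz_disjoint_lel (riesz_abs_linear c x y) _.
  apply: riesz_disjointD; rewrite ?riesz_abs_ge0 ?By//.
  by apply: riesz_disjointZ; rewrite ?riesz_abs_ge0 ?Bx.
- by move=> x y By xy a Aa; apply: riesz_disjoint_lel xy _; exact: By.
move=> D y DB [uby luby] a Aa.
have negD x : D x -> riesz_pos (- y) <= riesz_pos (- x).
  by move=> Dx; rewrite riesz_pos_homo ?riesz_lerN//; exact: uby.
(* A supremum of the empty set is below every vector, in particular below [0] and [y + y], hence is
   [0]. *)
have [[d Dd]|D0] := pselect (exists d, D d); last first.
  have ley x : y <= x by apply: luby => d Dd; case: D0; exists d.
  have -> : y = 0.
    by apply/le_anti; rewrite ley/= -(riesz_leD2rE y) add0r ley.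
  by rewrite riesz_ger0_abs ?lexx// riesz_disjoint0.
apply: riesz_disjoint_lel (riesz_absE y) _.
apply: riesz_disjointD; first exact: riesz_pos_ge0; last first.
  apply: riesz_disjoint_lel (le_trans (negD d Dd) (riesz_posN_abs d)) _.
  exact: DB.
set z := riesz_meet (riesz_pos y) a.
(* [y - z] is still an upper bound of [D]. *)
have : y <= y - z.
  apply: luby => x Dx; rewrite riesz_leBrDr.
  rewrite [x in leLHS]riesz_posB [y in leRHS]riesz_posB addrAC.
  apply: riesz_leD; last by rewrite riesz_lerN negD.
  apply: riesz_disjoint_leD; last exact: riesz_leIl.
    apply: riesz_disjoint_le (riesz_pos_abs x) (riesz_leIr _ _) _; exact: DB.
  by apply: riesz_pos_homo; exact: uby.
by rewrite riesz_leBrDr -[leRHS]addr0 ![y + _]addrC riesz_leD2rE.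
Qed.

End DisjointComplement.

(** * Order equivalence and the orbit of an atom *)

Section OrderEquivalence.
Context (R : realType) (gT : finGroupType).
Implicit Types rho theta : posrep R gT.

Lemma posrep1 rho x : rho 1%g x = x.
Proof.
have [/bij_inj inj1 _ _] := posrep_aut rho 1%g.
by apply: inj1; rewrite -posrepM mulg1.
Qed.

Lemma posrepK rho s : cancel (rho s) (rho s^-1%g).
Proof. by move=> x; rewrite -posrepM mulVg posrep1. Qed.

Lemma order_equivalent_refl rho : order_equivalent rho rho.
Proof.
by exists idfun; split=> //; split=> //; exists idfun.
Qed.

Lemma order_equivalent_sym rho theta :
  order_equivalent rho theta -> order_equivalent theta rho.
Proof.
move=> [T [isoT Trho]].
have [T' [isoT' TT' T'T]] := lattice_isomorphism_inv isoT.
by exists T'; split=> // s x; rewrite -[in LHS](T'T x) -Trho TT'.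
Qed.

Lemma order_equivalent_trans rho1 rho2 rho3 : order_equivalent rho1 rho2 ->
  order_equivalent rho2 rho3 -> order_equivalent rho1 rho3.
Proof.
move=> [T [[bT TI TU] Trho]] [S [[bS SI SU] Srho]].
exists (S \o T); split; last by move=> s x /=; rewrite Trho Srho.
split; first exact: bij_comp.
- by move=> x y /=; rewrite TI SI.
- by move=> x y /=; rewrite TU SU.
Qed.

Lemma order_classP rho theta :
  order_class rho = order_class theta <-> order_equivalent rho theta.
Proof.
split=> [eq_rt|eq_rt].
  by rewrite -/(order_class rho theta) eq_rt; exact: order_equivalent_refl.
apply/funext => sigma; apply/propext; split.
  exact/order_equivalent_trans/order_equivalent_sym.
exact: order_equivalent_trans.
Qed.

(* [G] is finite, so [rho s] has finite order and a nonnegative eigenvalue of it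
   is a root of unity. *)
Lemma posrep_eigenvalue rho s a (k : R) :
  0 < a -> 0 <= k -> rho s a = k *: a -> k = 1.
Proof.
move=> a0 k0 sa.
have pow n : rho (s ^+ n)%g a = k ^+ n *: a.
  elim: n => [|n IH]; first by rewrite expg0 posrep1 expr0 scale1r.
  by rewrite expgSr posrepM sa linearZ/= IH scalerA exprS.
have : k ^+ #[s]%g = 1.
  apply/eqP; rewrite -subr_eq0; have := pow #[s]%g.
  rewrite expg_order posrep1 -[X in X = _]scale1r => /esym/eqP.
  rewrite -subr_eq0 -scalerBl scaler_eq0 => /orP[//|/eqP a00].
  by move: a0; rewrite a00 ltxx.
by move/eqP; rewrite pexpr_eq1 ?order_gt0// => /eqP.
Qed.

End OrderEquivalence.

Section AtomOrbit.
Context (R : realType) (gT : finGroupType) (rho : posrep R gT) (H : {group gT}).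
Context (a : posrep_space rho) (atom_a : riesz_atom a).
Context (stab_a : forall s, s \in H <-> rho s a = a).

Lemma coset_eltP (A : coset_space H) : exists t, A = coset_elt H t.
Proof.
by case: A => A AH; case/lcosetsP: (AH) => t _ At; exists t; exact: val_inj.
Qed.

(** The representative chosen by [repr] does not matter, since [H] fixes [a]; [orbit_vec_elt]
    records this. *)
Definition orbit_vec (A : coset_space H) : posrep_space rho :=
  rho (repr (val A)) a.

Lemma orbit_vec_elt t : orbit_vec (coset_elt H t) = rho t a.
Proof.
rewrite /orbit_vec /=; have := mem_repr t (lcoset_refl H t).
rewrite mem_lcoset => /stab_a h.
by rewrite -{2}h -posrepM mulgA mulgV mul1g.
Qed.

Lemma orbit_vec_act s A : orbit_vec (coset_act s A) = rho s (orbit_vec A).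
Proof.
have [t ->] := coset_eltP A; rewrite orbit_vec_elt -posrepM -orbit_vec_elt.
by congr orbit_vec; apply: val_inj; rewrite /= lcosetM.
Qed.

Lemma orbit_vec_atom A : riesz_atom (orbit_vec A).
Proof. exact: lattice_isomorphism_atom (posrep_aut _ _) atom_a. Qed.

Lemma orbit_vec_gt0 A : 0 < orbit_vec A.
Proof. by have [] := orbit_vec_atom A. Qed.

(** If the translates by [s] and [t] are not disjoint, [t^-1 * s] scales [a] by a nonnegative
    factor, which must be 1; so [t^-1 * s] lies in [H] and the cosets agree. *)
Lemma orbit_vec_disjoint A B :
  A != B -> riesz_disjoint (orbit_vec A) (orbit_vec B).
Proof.
apply: contraNT => /(riesz_atom_disjoint (orbit_vec_atom A) (orbit_vec_atom B)).
have [s ->] := coset_eltP A; have [t ->] := coset_eltP B.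
rewrite !orbit_vec_elt => -[k k0 sk].
have tsk : rho (t^-1 * s)%g a = k *: a by rewrite posrepM sk linearZ/= posrepK.
have k1 := posrep_eigenvalue (proj1 atom_a) k0 tsk.
apply/eqP/val_inj => /=; apply/lcoset_eqP; rewrite mem_lcoset.
by apply/stab_a; rewrite tsk k1 scale1r.
Qed.

Definition orbit_map (f : {ffun coset_space H -> R^o}) : posrep_space rho :=
  \sum_A (f A : R) *: orbit_vec A.

Lemma orbit_map_linear : linear orbit_map.
Proof.
move=> c f g; rewrite /orbit_map scaler_sumr -big_split/=.
by apply: eq_bigr => A _; rewrite !ffunE scalerDl scalerA.
Qed.

HB.instance Definition _ :=
  GRing.isLinear.Build R {ffun coset_space H -> R^o} (posrep_space rho) _
    orbit_map orbit_map_linear.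

Lemma orbit_map_act s f : orbit_map (canonical_act s f) = rho s (orbit_map f).
Proof.
rewrite /orbit_map linear_sum (reindex_inj (can_inj (coset_actK s)))/=.
apply: eq_bigr => A _.
by rewrite canonical_actE coset_actK orbit_vec_act linearZ.
Qed.

Lemma orbit_map_ge0 f : (0 <= orbit_map f) = (0 <= f).
Proof.
apply/idP/forallP => [f0 A|f0].
  rewrite ffunE.
  exact: (riesz_disjoint_family_ge0 orbit_vec_gt0 orbit_vec_disjoint f0).
apply: riesz_sumr_ge0 => A _; apply: riesz_scale_ge0; last exact/ltW/orbit_vec_gt0.
by have := f0 A; rewrite ffunE.
Qed.

Lemma orbit_map_le : {mono orbit_map : f g / f <= g}.
Proof.
by move=> f g; rewrite -riesz_subr_ge0 -[in RHS]riesz_subr_ge0 -raddfB orbit_map_ge0.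
Qed.

Context (arch : archimedean (posrep_space rho)) (irr : irreducible rho).

Lemma orbit_complement_eq0 (x : posrep_space rho) :
  0 <= x -> (forall A, riesz_disjoint x (orbit_vec A)) -> x = 0.
Proof.
move=> x0 xd; have := irr (disjoint_complement_band (range orbit_vec)).
case.
(* Invariance holds because the representation permutes the orbit. *)
- move=> s y By _ [A _ <-].
  have isos := posrep_aut rho s.
  rewrite -lattice_isomorphism_abs// -(coset_actKV s A) orbit_vec_act.
  by rewrite lattice_isomorphism_disjoint//; apply: By; exists (coset_act s^-1 A).
- move/seteqP => [+ _]; move/(_ x); apply => _ [A _ <-].
  by rewrite riesz_ger0_abs.
(* The complement is not the whole space: [a] lies in its own orbit and is not disjoint from
   itself. *)
have [a0 _] := atom_a; move/seteqP => [_ /(_ a I) Ba].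
have /Ba : range orbit_vec a.
  by exists (coset_elt H 1) => //; rewrite orbit_vec_elt posrep1.
rewrite riesz_ger0_abs ?ltW// => /riesz_disjoint_self.
by move/(lt_le_trans a0); rewrite ltxx.
Qed.

Lemma orbit_map_surj_ge0 (x : posrep_space rho) :
  0 <= x -> exists f, orbit_map f = x.
Proof.
move=> x0.
have [d dP] := choice (fun A => riesz_atom_remainder arch (orbit_vec_atom A) x0).
exists [ffun A => d A].
have dvec0 A : 0 <= d A *: orbit_vec A.
  by have [d0 _ _] := dP A; rewrite riesz_scale_ge0// ltW// orbit_vec_gt0.
have mapE : orbit_map [ffun A => d A] = \sum_A d A *: orbit_vec A.
  by apply: eq_bigr => A _; rewrite ffunE.
(* Pairwise disjoint vectors that are each below [x] have their sum below [x]. *)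
have le_x : orbit_map [ffun A => d A] <= x.
  rewrite mapE; apply: riesz_disjoint_sum_le => //.
  - exact: index_enum_uniq.
  - move=> A B AB; have [dA _ _] := dP A; have [dB _ _] := dP B.
    rewrite riesz_disjointZ// ?ltW ?orbit_vec_gt0// riesz_disjointC.
    by rewrite riesz_disjointZ// ?ltW ?orbit_vec_gt0// orbit_vec_disjoint// eq_sym.
  - by move=> A; have [_ ] := dP A.
apply/esym/eqP; rewrite -subr_eq0; apply/eqP/orbit_complement_eq0.
  by rewrite riesz_subr_ge0.
(* Subtracting the whole sum leaves at most [x - d A *: orbit_vec A], already disjoint from
   [orbit_vec A]. *)
move=> A; have [_ _ dA] := dP A; apply: riesz_disjoint_lel dA.
by rewrite mapE riesz_leD// riesz_lerN (bigD1 A)//= -[leLHS]addr0 riesz_leD// riesz_sumr_ge0.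
Qed.

Lemma orbit_order_equivalent : order_equivalent (canonical_rep R H) rho.
Proof.
exists orbit_map; split; last exact: orbit_map_act.
apply: order_isomorphism_lattice; last exact: orbit_map_le.
have surj x : exists f, orbit_map f = x.
  have [f fx] := orbit_map_surj_ge0 (riesz_pos_ge0 x).
  have [g gx] := orbit_map_surj_ge0 (riesz_pos_ge0 (- x)).
  by exists (f - g); rewrite raddfB/= fx gx -riesz_posB.
(* [g] is a right inverse by choice, and a left inverse because [orbit_map] reflects the order. *)
have [g gK] := choice surj; exists g => // f.
by apply/le_anti; rewrite -!orbit_map_le !gK lexx.
Qed.

End AtomOrbit.

(** * Canonical representations *)

Section FunctionSpace.
Context (R : realType) (T : finType).
Implicit Types f g : {ffun T -> R^o}.

Lemma ffun_leP f g : reflect (forall x, (f x : R) <= g x) (f <= g).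
Proof. exact: forallP. Qed.

Lemma ffun_neq0 f : f <> 0 -> exists x, (f x : R) != 0.
Proof.
move=> f0; apply: contrapT => nf; apply: f0; apply/ffunP => x; rewrite ffunE.
by apply/eqP/negPn/negP => fx; apply: nf; exists x.
Qed.

Lemma riesz_abs_ffunE f x : riesz_abs f x = `|f x : R|.
Proof. by rewrite ffunE ffunE maxrN. Qed.

Lemma ffun_archimedean : archimedean {ffun T -> R^o}.
Proof.
move=> f g /ffun_leP f0 nfg; apply/ffunP => x; rewrite ffunE.
apply/le_anti; have := f0 x; rewrite ffunE => ->; rewrite andbT leNgt.
apply/negP => fx0.
have g0 : 0 <= (g x : R) by have /ffun_leP/(_ x) := nfg 0%N; rewrite ffunE.
(* This integer exceeds [g x / f x], so that multiple of [f] passes [g] at [x]. *)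
have := nfg (Num.truncn ((g x : R) / f x)).+1 => /ffun_leP/(_ x).
rewrite ffunMnE -mulr_natl -ler_pdivlMr// leNgt => /negP; apply.
exact: truncnS_gt.
Qed.

End FunctionSpace.

Section CanonicalRepresentation.
Context (R : realType) (gT : finGroupType) (H : {group gT}).
Implicit Types (A B : coset_space H) (f : {ffun coset_space H -> R^o}).

Lemma ffun_coset_basisE f : f = \sum_A (f A : R) *: coset_basis R A.
Proof.
apply/ffunP => B; rewrite sum_ffunE (bigD1 B)//= !ffunE eqxx big1 => [|A AB].
  by rewrite addr0 -[RHS]/((f B : R) * 1) mulr1.
by rewrite !ffunE (negbTE AB) scaler0.
Qed.

Lemma coset_basis_atom A : riesz_atom (coset_basis R A : coset_riesz R H).
Proof.
split.
  rewrite lt_def; apply/andP; split.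
    apply/eqP => /ffunP/(_ A); rewrite !ffunE eqxx => /eqP.
    by rewrite oner_eq0.
  by apply/ffun_leP => B; rewrite !ffunE.
move=> f /ffun_leP f0 /ffun_leP fA; exists (f A); apply/ffunP => B.
rewrite !ffunE; have [<-|AB] := eqVneq A B.
  by rewrite -[RHS]/((f A : R) * 1) mulr1.
rewrite scaler0; apply/le_anti; move: (f0 B) (fA B).
by rewrite !ffunE (negbTE AB) => -> ->.
Qed.

Lemma coset_basis_le A f : 0 <= f -> (f A : R) *: coset_basis R A <= f.
Proof.
move=> /ffun_leP f0; apply/ffun_leP => B; rewrite !ffunE.
have [<-|AB] := eqVneq A B; first by rewrite -[leLHS]/((f A : R) * 1) mulr1.
by rewrite scaler0; have := f0 B; rewrite ffunE.
Qed.

(** Where [f A] is nonzero, [f A *: coset_basis R A] lies below the atom [f], hence is a multiple of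
    it; comparing values at [A] shows the factor is 1. *)
Lemma riesz_atom_coset f : riesz_atom (f : coset_riesz R H) ->
  exists t (c : R), 0 < c /\ f = c *: coset_basis R (coset_elt H t).
Proof.
move=> [f0 af]; have fge0 := ltW f0.
have [A fA] : exists A, (f A : R) != 0.
  by apply: ffun_neq0 => fE0; move: f0; rewrite fE0 ltxx.
have fA0 : 0 < (f A : R).
  by rewrite lt_def fA; have /ffun_leP/(_ A) := fge0; rewrite ffunE.
have [t tA] := coset_eltP A.
exists t, (f A); split=> //; rewrite -tA.
have [|c fc] := af ((f A : R) *: coset_basis R A) _ (coset_basis_le A fge0).
  apply: riesz_scale_ge0; first exact: ltW.
  by have [/ltW] := coset_basis_atom A.
have /ffunP/(_ A) := fc; rewrite !ffunE eqxx.
rewrite -[LHS]/((f A : R) * 1) -[RHS]/(c * (f A : R)) mulr1 => cf.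
suff c1 : c = 1 by rewrite fc c1 scale1r.
by apply: (mulIf fA); rewrite -cf mul1r.
Qed.

(** The stabiliser of [tH] is [t H t^-1], which is [H :^ t^-1] because [:^] conjugates on the
    right. *)
Lemma coset_basis_stab s t :
  s \in (H :^ t^-1)%g <->
  canonical_act s (coset_basis R (coset_elt H t)) = coset_basis R (coset_elt H t).
Proof.
rewrite canonical_act_basis; split.
  rewrite mem_conjg invgK => sH; congr coset_basis; apply: val_inj => /=.
  by apply/lcoset_eqP; rewrite mem_lcoset.
move/ffunP/(_ (coset_elt H t)); rewrite !ffunE eqxx.
case: eqP => [[/lcoset_eqP]|_ /eqP]; last by rewrite eq_sym oner_eq0.
by rewrite mem_lcoset mem_conjg invgK.
Qed.

Lemma canonical_rep_irreducible_fd_archimedean :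
  irreducible_fd_archimedean (canonical_rep R H).
Proof.
split.
- exists (coset_basis R (coset_elt H 1)) => e0.
  by have [] := coset_basis_atom (coset_elt H 1); rewrite e0 ltxx.
- exists #|{: coset_space H}|, (fun i => coset_basis R (enum_val i)) => f.
  exists (fun i => f (enum_val i)).
  rewrite {1}(ffun_coset_basisE f).
  exact: (reindex _ (onW_bij _ (enum_val_bij _))).
- exact: ffun_archimedean.
move=> B [[[B0 Blin] Bsolid] _] Binv.
have [B1|nB] := pselect (B `<=` [set 0]).
  by left; apply/seteqP; split=> // x ->.
right; apply/seteqP; split=> // g _.
have [f [Bf f0]] : exists f, B f /\ f <> 0.
  apply: contrapT => nf; apply: nB => f Bf; apply: contrapT => f0; apply: nf.
  by exists f.
have [A fA] := ffun_neq0 f0.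
have BZ (c : R) x : B x -> B (c *: x).
  by move=> Bx; rewrite -[_ *: _]addr0; exact: Blin.
(* By solidity: [f A *: coset_basis R A] is dominated by [f] in absolute value. *)
have BA : B (coset_basis R A).
  rewrite -[coset_basis R A](scalerK fA); apply: BZ.
  apply: Bsolid Bf _; apply/ffun_leP => C.
  rewrite !riesz_abs_ffunE !ffunE; have [<-|AC] := eqVneq A C.
    by rewrite -[X in `|X|]/((f A : R) * 1) mulr1.
  by rewrite scaler0 normr0.
(* By transitivity: [s * t^-1] carries the coset of [t] to that of [s]. *)
have BC C : B (coset_basis R C).
  have [t tA] := coset_eltP A; have [s sC] := coset_eltP C.
  have := Binv (s * t^-1)%g _ BA; rewrite tA.
  by rewrite /= canonical_act_basis mulgKV -sC.
rewrite (ffun_coset_basisE g); apply: big_ind => //.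
  by move=> x y Bx By; rewrite -[x]scale1r; exact: Blin.
by move=> C _; exact: BZ.
Qed.

End CanonicalRepresentation.

(** * Classification up to conjugacy *)

Section Classification.
Context (R : realType) (gT : finGroupType).
Implicit Types H : {group gT}.

Lemma conjugacy_classP H1 H2 :
  conjugacy_class H1 = conjugacy_class H2 <-> exists x : gT, (H2 :=: H1 :^ x)%g.
Proof.
split=> [H12|[x H2E]].
  have : (H2 : {set gT}) \in conjugacy_class H1 by rewrite H12 orbit_refl.
  by move=> /imsetP[x _ ->]; exists x.
apply/esym/orbit_eqP/imsetP; exists x; rewrite ?inE//.
Qed.

(** In the representation of [H2], the atom at the coset of [x] has stabiliser [H2 :^ x^-1 = H1], so
    its orbit map is the required equivalence. *)
Lemma conjugate_order_equivalent H1 H2 : (exists x : gT, (H2 :=: H1 :^ x)%g) ->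
  order_equivalent (canonical_rep R H1) (canonical_rep R H2).
Proof.
move=> [x H2E].
have [_ _ arch irr] := canonical_rep_irreducible_fd_archimedean R H2.
apply: (@orbit_order_equivalent _ _ (canonical_rep R H2) _
  (coset_basis R (coset_elt H2 x))) arch irr; first exact: coset_basis_atom.
move=> s; have -> : s \in H1 = (s \in H2 :^ x^-1)%g by rewrite H2E conjsgK.
exact: coset_basis_stab.
Qed.

(** [T] sends the basis vector of [H1] to a positive multiple of that of some coset of [t];
    equivariance makes their stabilisers [H1] and [H2 :^ t^-1] equal. *)
Lemma order_equivalent_conjugate H1 H2 :
  order_equivalent (canonical_rep R H1) (canonical_rep R H2) ->
  exists x : gT, (H2 :=: H1 :^ x)%g.
Proof.
move=> [T [isoT Trho]].
set e := coset_basis R (coset_elt H1 1).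
have [t [c [c0 Te]]] := riesz_atom_coset
  (lattice_isomorphism_atom isoT (coset_basis_atom R (coset_elt H1 1))).
have [/bij_inj injT _ _] := isoT.
have fixE s : canonical_act s e = e <->
    canonical_act s (coset_basis R (coset_elt H2 t)) =
      coset_basis R (coset_elt H2 t).
  have cK := scalerI (lt0r_neq0 c0).
  have TsE : T (canonical_act s e) =
      c *: canonical_act s (coset_basis R (coset_elt H2 t)).
    by rewrite -linearZ -Te; exact: Trho.
  split=> [se|st]; first by apply: cK; rewrite -TsE se Te.
  by apply: injT; rewrite TsE st -Te.
suff H12 : H1 :=: (H2 :^ t^-1)%g by exists t; rewrite H12 conjsgKV.
apply/setP => s.
have -> : (s \in H1) = (s \in H1 :^ 1^-1)%g by rewrite invg1 conjsg1.
by apply/idP/idP => /coset_basis_stab/fixE/coset_basis_stab.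
Qed.

Lemma irreducible_canonical (rho : posrep R gT) :
  irreducible_fd_archimedean rho ->
  exists H, order_equivalent (canonical_rep R H) rho.
Proof.
move=> [nz fd arch irr]; have [a atom_a] := fd_archimedean_atom arch fd nz.
have group_stab : group_set [set s | rho s a == a]%SET.
  apply/group_setP; split=> [|s t]; first by rewrite inE posrep1.
  by rewrite !inE posrepM => /eqP sa /eqP ->; rewrite sa.
exists (Group group_stab); apply: orbit_order_equivalent atom_a _ arch irr.
by move=> s; rewrite inE; split=> /eqP.
Qed.

End Classification.

Theorem theorem4p10 (R : realType) (gT : finGroupType) :
  (forall H1 H2 : {group gT},
      (exists x : gT, (H2 :=: H1 :^ x)%g) ->
      order_equivalent (canonical_rep R H1) (canonical_rep R H2)) /\
  exists f : subgroup_classes gT -> irreducible_order_classes R gT,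
    (forall H : {group gT},
        sval (f (class_of_subgroup H)) = order_class (canonical_rep R H)) /\
    bijective f.
Proof.
split; first exact: conjugate_order_equivalent.
pose rep (C : subgroup_classes gT) := sval (cid (svalP C)).
have repP C : sval C = conjugacy_class (rep C) := svalP (cid (svalP C)).
pose f C : irreducible_order_classes R gT :=
  exist _ (order_class (canonical_rep R (rep C)))
    (ex_intro _ _ (conj (canonical_rep_irreducible_fd_archimedean R (rep C)) erefl)).
(* The chosen representative of the class of [H] is only conjugate to [H], which suffices for the
   order class. *)
have fE H : sval (f (class_of_subgroup H)) = order_class (canonical_rep R H).
  apply/order_classP/conjugate_order_equivalent/conjugacy_classP.
  by rewrite -repP.
exists f; split=> //.
have sval_inj (C D : subgroup_classes gT) : sval C = sval D -> C = D.
  by case: C D => [C pC] [D pD]; exact: eq_exist.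
have surj c : exists H, c = f (class_of_subgroup H).
  case: c => c [rho [irr_rho cE]].
  have [H Hrho] := irreducible_canonical irr_rho.
  by exists H; apply: eq_exist; rewrite cE -[RHS]/(sval (f _)) fE; exact/esym/order_classP.
have [g gP] := choice surj; exists (fun c => class_of_subgroup (g c)) => // C.
(* What remains is injectivity of [f]: equal order classes come from conjugate subgroups. *)
apply: sval_inj; rewrite /= repP; apply/conjugacy_classP.
apply/order_equivalent_conjugate/order_classP.
exact: etrans (esym (fE _)) (congr1 sval (esym (gP (f C)))).
Qed.
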